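(* Let $(X,\|\cdot\|_X)$ be a complex normed linear space which is closed relative to the topology induced by the metric defined by its norm, let $H$ be a Hilbert space, and let $F:X\to L(H)$ be a bounded $L(H)$-valued norm on $X$. Then $X$ is complete with respect to $F$ if and only if $F$ is continuous at $0$.
   Context: All spaces are over $\mathbb{C}$. $L(H)$ is the space of bounded linear operators on $H$ with the operator norm $\|T\|=\sup_{\|h\|=1}\|Th\|$; continuity of $F$ is with respect to the norm of $X$ and the operator norm on $L(H)$. For self-adjoint $S,T\in L(H)$, $S\le T$ means that $T-S$ is a positive operator, i.e. $((T-S)h,h)\ge 0$ for all $h\in H$. A function $F:X\to L(H)$ is an $L(H)$-valued norm on $X$ if: (1) $F(x)\ge 0$ (i.e. $F(x)$ is a positive operator) for every $x\in X$; (2) $F(x+y)\le F(x)+F(y)$ for all $x,y\in X$; (3) $F(\lambda x)=|\lambda|F(x)$ for all $\lambda\in\mathbb{C}$ and $x\in X$; (4) $F(x)=0$ if and only if $x=0$. It is bounded if $\sup_{\|x\|_X=1}\|F(x)\|<\infty$. $X$ is said to be complete with respect to $F$ if for every Cauchy sequence $\{x_n\}_{n=1}^\infty$ in $X$, the sequence $\{F(x_n)\}_{n=1}^\infty$ is a Cauchy sequence in $L(H)$. *)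

(* Defs.v *)
From HB Require Import structures.
From mathcomp Require Import all_boot all_order all_algebra.
From mathcomp Require Import complex sesquilinear.
From mathcomp Require Import all_classical all_reals all_analysis.

Set Implicit Arguments.
Unset Strict Implicit.
Unset Printing Implicit Defensive.
Import Order.TTheory GRing.Theory Num.Theory.
Import numFieldNormedType.Exports.

Local Open Scope classical_set_scope.
Local Open Scope complex_scope.
Local Open Scope ring_scope.

(* The inner product is linear in its first argument and conjugate-linear in
   the second one. *)
HB.mixin Record CompleteNormedModule_isHilbert (R : realType) H
    of CompleteNormedModule R[i] H := {
  dotp : {dot H for (@Num.conj R[i])} ;
  sqr_norm_dotp : forall h : H, `|h| ^+ 2 = dotp h h
}.

#[short(type="hilbertType")]
HB.structure Definition Hilbert (R : realType) :=
  {H of CompleteNormedModule_isHilbert R H & CompleteNormedModule R[i] H}.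

Section BoundedOperators.
Variables (R : realType) (V : normedModType R[i]).

Definition bounded_operator : {pred V -> V} := fun T =>
  `[< linear T /\ exists M : R[i], forall h, `|T h| <= M * `|h| >].

Lemma bounded_operator_submod : submod_closed bounded_operator.
Proof.
split=> [|a S T /asboolP[lS [M SM]] /asboolP[lT [N TN]]]; apply/asboolP; split.
- by move=> a u v; rewrite scaler0 addr0.
- by exists 0 => h; rewrite normr0 mul0r.
- move=> b u v; rewrite -![LHS]/(a *: S _ + T _) -/(a *: S _ + T _).
  rewrite lS lT !scalerDr !scalerA mulrC.
  by rewrite -!addrA; congr (_ + _); rewrite addrCA.
- exists (`|a| * M + N) => h; rewrite -![X in `|X|]/(a *: S h + T h).
  rewrite (le_trans (ler_normD _ _))// normrZ mulrDl lerD// -mulrA.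
  exact: ler_wpM2l.
Qed.

HB.instance Definition _ := GRing.isSubmodClosed.Build _ _ bounded_operator
  bounded_operator_submod.

Record boundedOp := BoundedOp {
  boundedOp_fun :> V -> V ;
  boundedOpP : boundedOp_fun \in bounded_operator
}.

HB.instance Definition _ := [isSub for boundedOp_fun].
HB.instance Definition _ := [Choice of boundedOp by <:].
HB.instance Definition _ := [SubChoice_isSubLmodule of boundedOp by <:].

Lemma boundedOpDE (S T : boundedOp) h : (S + T) h = S h + T h.
Proof. by []. Qed.

Lemma boundedOpBE (S T : boundedOp) h : (S - T) h = S h - T h.
Proof. by []. Qed.

Lemma boundedOpZE a (T : boundedOp) h : (a *: T) h = a *: T h.
Proof. by []. Qed.

Lemma boundedOp_linear (T : boundedOp) : linear T.
Proof. by case: T => T /= /asboolP[]. Qed.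

(* Norms over R[i] take their values in R[i], and so does opnorm.  For V = {0}
   the set of values is empty, with supremum 0. *)
Definition opnorm (T : boundedOp) : R[i] :=
  (sup [set complex.Re `|T h| | h in [set h | `|h| = 1]])%:C.

Let ReK (z : R[i]) : 0 <= z -> (complex.Re z)%:C = z.
Proof. by case: z => a b; rewrite lecE/= => /andP[/eqP-> _]. Qed.

Let opnorm_has_ubound (T : boundedOp) :
  has_ubound [set complex.Re `|T h| | h in [set h | `|h| = 1]].
Proof.
case: (T) => f /= /asboolP[_ [M fM]]; exists (complex.Re M).
move=> _ [h /= h1 <-]; have := fM h; rewrite h1 mulr1.
by rewrite lecE => /andP[].
Qed.

Let le_opnorm1 (T : boundedOp) h : `|h| = 1 -> `|T h| <= opnorm T.
Proof.
move=> h1; rewrite -(ReK (normr_ge0 _)) lecR.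
by apply: ub_le_sup; [exact: opnorm_has_ubound|exists h].
Qed.

Let opnorm_le (T : boundedOp) (M : R[i]) : 0 <= M ->
  (forall h, `|h| = 1 -> `|T h| <= M) -> opnorm T <= M.
Proof.
move=> M0 TM; rewrite -(ReK M0) lecR; set A := (X in sup X).
have [->|/set0P A0] := eqVneq A set0.
  by rewrite sup0; move: M0; rewrite lecE => /andP[].
apply: ge_sup => // _ [h /= h1 <-].
by rewrite -lecR (ReK (normr_ge0 _)) (ReK M0) TM.
Qed.


Let boundedOp0 (T : boundedOp) : T 0 = 0.
Proof.
have := boundedOp_linear T (-1) 0 0.
by rewrite !scaleN1r !addNr.
Qed.

Let boundedOpZ (T : boundedOp) a h : T (a *: h) = a *: T h.
Proof.
by have := boundedOp_linear T a h 0; rewrite boundedOp0 !addr0.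
Qed.

Lemma opnorm_ge0 (T : boundedOp) : 0 <= opnorm T.
Proof.
rewrite -[0]/(0%:C) lecR; set A := (X in sup X).
have [->|/set0P[x Ax]] := eqVneq A set0; first by rewrite sup0.
apply: le_trans (ub_le_sup (opnorm_has_ubound T) Ax).
by case: Ax => h _ <-; rewrite -lecR (ReK (normr_ge0 _)) normr_ge0.
Qed.

Lemma le_opnorm (T : boundedOp) h : `|T h| <= opnorm T * `|h|.
Proof.
have [->|h0] := eqVneq h 0; first by rewrite boundedOp0 !normr0 mulr0.
have nh0 : 0 < `|h| by rewrite normr_gt0.
have := @le_opnorm1 T (`|h|^-1 *: h).
rewrite boundedOpZ !normrZ normfV normr_id mulVf ?gt_eqF// => /(_ erefl).
by rewrite mulrC ler_pdivrMr.
Qed.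

Let opnormD (S T : boundedOp) : opnorm (S + T) <= opnorm S + opnorm T.
Proof.
apply: opnorm_le => [|h h1]; first by rewrite addr_ge0 ?opnorm_ge0.
by rewrite boundedOpDE (le_trans (ler_normD _ _))// lerD ?le_opnorm1.
Qed.

Let opnormZ_le a (T : boundedOp) : opnorm (a *: T) <= `|a| * opnorm T.
Proof.
apply: opnorm_le => [|h h1]; first by rewrite mulr_ge0 ?opnorm_ge0.
by rewrite boundedOpZE normrZ ler_wpM2l ?le_opnorm1.
Qed.

Let opnormZ a (T : boundedOp) : opnorm (a *: T) = `|a| * opnorm T.
Proof.
apply/eqP; rewrite eq_le opnormZ_le/=.
have [->|a0] := eqVneq a 0; first by rewrite normr0 mul0r opnorm_ge0.
have na0 : 0 < `|a| by rewrite normr_gt0.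
have := opnormZ_le a^-1 (a *: T).
by rewrite scalerA mulVf// scale1r normfV mulrC ler_pdivlMr// mulrC.
Qed.

Let opnorm0_eq0 (T : boundedOp) : opnorm T = 0 -> T = 0.
Proof.
move=> T0; apply/val_inj/funext => h; apply/eqP; rewrite -normr_le0.
by have := le_opnorm T h; rewrite T0 mul0r.
Qed.

HB.instance Definition _ := Lmodule_isNormed.Build R[i] boundedOp
  opnormD opnormZ opnorm0_eq0.

Lemma normr_boundedOpE (T : boundedOp) : `|T| = opnorm T.
Proof. by []. Qed.

End BoundedOperators.

Section OperatorValuedNorm.
Variables (R : realType) (X : normedModType R[i]) (H : hilbertType R).

(* 0 <= z in R[i] means that z is a nonnegative real. *)
Definition positive_op (T : boundedOp H) : Prop :=
  forall h : H, 0 <= dotp (T h) h.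

Definition le_op (S T : boundedOp H) : Prop := positive_op (T - S).

Definition op_norm_on (F : X -> boundedOp H) : Prop :=
  [/\ forall x, positive_op (F x),
      forall x y, le_op (F (x + y)) (F x + F y),
      forall (l : R[i]) x, F (l *: x) = `|l| *: F x
    & forall x, F x = 0 <-> x = 0].

Definition bounded_op_norm (F : X -> boundedOp H) : Prop :=
  [bounded F x | x in [set x : X | `|x| = 1]].

Definition complete_wrt (F : X -> boundedOp H) : Prop :=
  forall x_ : nat -> X, cauchy (x_ @ \oo) -> cauchy (F (x_ n) @[n --> \oo]).

End OperatorValuedNorm.

(* Main.v *)
(** [F] is always Lipschitz, so both sides of the equivalence hold. Applied to
    [x = (x - y) + y] and to [y = (y - x) + x], subadditivity gives
    [- F (x - y) <= F x - F y <= F (x - y)], hence the quadratic form of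
    [F x - F y] is dominated by [`|F (x - y)| * `|h| ^+ 2]. By polarization, an
    operator over the complex numbers has norm at most twice such a bound, and
    [`|F (x - y)| <= M * `|x - y|] by homogeneity and boundedness. *)
Require Import Defs.
From mathcomp Require Import all_boot all_order all_algebra.
From mathcomp Require Import complex.
From mathcomp Require Import sesquilinear ring.
From mathcomp Require Import all_classical all_reals all_analysis.
Import Order.TTheory GRing.Theory Num.Theory.
Import numFieldNormedType.Exports.
Local Open Scope classical_set_scope.
Local Open Scope complex_scope.
Local Open Scope ring_scope.

Lemma dotpZl (R : realType) (H : hilbertType R) (a : R[i]) (u v : H) :
  dotp (a *: u) v = a * dotp u v.
Proof. by rewrite linearZl_LR. Qed.

Lemma dotpZr (R : realType) (H : hilbertType R) (a : R[i]) (u v : H) :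
  dotp u (a *: v) = a^* * dotp u v.
Proof. by rewrite linearZr. Qed.

Lemma dotp_conjC (R : realType) (H : hilbertType R) (u v : H) :
  dotp v u = (dotp u v)^*.
Proof. by rewrite hermC expr0 mul1r. Qed.

Lemma norm_dotp_le (R : realType) (H : hilbertType R) (u v : H) :
  `|dotp u v| <= `|u| * `|v|.
Proof.
have [->|v0] := eqVneq v 0; first by rewrite linear0r !normr0 mulr0.
have nv0 : `|v| ^+ 2 != 0 by rewrite expf_neq0// normr_eq0.
rewrite -ler_sqr ?nnegrE ?mulr_ge0// exprMn normCK.
(* [c *: v] is the orthogonal projection of [u] onto the line spanned by [v]; Cauchy-Schwarz is the
   nonnegativity of the squared norm of the remainder. *)
set d := dotp u v; set c := d / `|v| ^+ 2.
have cC : c^* = d^* / `|v| ^+ 2.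
  by rewrite rmorphM fmorphV rmorphXn/= (conj_Creal (normr_real _)).
have : 0 <= `|u - c *: v| ^+ 2 by rewrite exprn_ge0.
rewrite sqr_norm_dotp linearBl !linearBr/= !dotpZl !dotpZr.
rewrite (dotp_conjC _ _ u v) -/d -!sqr_norm_dotp cC /c.
rewrite divfK// subrr subr0 subr_ge0 mulrAC [d^* * d]mulrC.
by rewrite ler_pdivrMr// ?exprn_gt0 ?normr_gt0//.
Qed.

Lemma parallelogram (R : realType) (H : hilbertType R) (u v : H) :
  `|u + v| ^+ 2 + `|u - v| ^+ 2 = 2 * (`|u| ^+ 2 + `|v| ^+ 2).
Proof.
rewrite !sqr_norm_dotp hnormD hnormB; ring.
Qed.

(** [0 <= M] covers [V = {0}], which has no unit vectors and where the supremum defaults to 0. *)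
Lemma opnorm_le (R : realType) (V : normedModType R[i]) (T : boundedOp V)
    (M : R[i]) :
  0 <= M -> (forall h, `|h| = 1 -> `|T h| <= M) -> `|T| <= M.
Proof.
rewrite normr_boundedOpE /opnorm; case: M => a b.
rewrite lecE/= => /andP[/eqP b0 a0] TM; rewrite b0 lecR.
set A := (X in sup X).
have [->|/set0P A0] := eqVneq A set0; first by rewrite sup0.
apply: ge_sup => // _ [h /= h1 <-].
by have := TM h h1; rewrite lecE/= => /andP[].
Qed.

Lemma boundedOpD (R : realType) (V : normedModType R[i]) (T : boundedOp V)
  (u v : V) : T (u + v) = T u + T v.
Proof. by have := boundedOp_linear T 1 u v; rewrite !scale1r. Qed.

Lemma boundedOpZ (R : realType) (V : normedModType R[i]) (T : boundedOp V)
  (a : R[i]) (v : V) : T (a *: v) = a *: T v.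
Proof.
have T0 : T 0 = 0 by apply: (addIr (T 0)); rewrite -boundedOpD !add0r.
by have := boundedOp_linear T a v 0; rewrite T0 !addr0.
Qed.

Lemma quadraticD (R : realType) (H : hilbertType R) (T : boundedOp H)
    (a : R[i]) (h k : H) :
  dotp (T (h + a *: k)) (h + a *: k) =
  dotp (T h) h + a^* * dotp (T h) k + a * dotp (T k) h
    + a * a^* * dotp (T k) k.
Proof.
rewrite boundedOpD boundedOpZ linearDl !linearDr/= !dotpZl !dotpZr.
by rewrite !addrA mulrA.
Qed.

(** The right-hand side is the sum of [a * Q (h + a *: k)] over the fourth roots of unity [a]. The
    sums of [a] and of [a ^+ 2] vanish, so only the terms with [a * a^* = 1] survive, four times. *)
Lemma polarization (R : realType) (H : hilbertType R) (T : boundedOp H)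
    (h k : H) (Q := fun v => dotp (T v) v) :
  4 * dotp (T h) k = Q (h + k) - Q (h - k)
    + 'i * Q (h + 'i *: k) - 'i * Q (h - 'i *: k).
Proof.
rewrite /Q -[in h + k](scale1r k) -(scaleN1r k) -[- ('i *: k)]scaleNr.
rewrite !quadraticD !rmorphN/= !rmorph1 conjCi.
have i2 : 'i * 'i = -1 :> R[i] by rewrite -expr2 sqrCi.
ring: i2.
Qed.

Lemma norm_quadratic_le (R : realType) (H : hilbertType R) (T : boundedOp H)
    (M : R[i]) :
  0 <= M -> (forall h, `|dotp (T h) h| <= M * `|h| ^+ 2) -> `|T| <= 2 * M.
Proof.
move=> M0 TM; apply: opnorm_le => [|h h1]; first by rewrite mulr_ge0.
have [->|Th0] := eqVneq (T h) 0; first by rewrite normr0 mulr_ge0.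
have nTh : `|T h| != 0 by rewrite normr_eq0.
(* Pairing [T h] with this unit vector recovers its norm. *)
pose k := `|T h|^-1 *: T h.
have k1 : `|k| = 1 by rewrite normrZ normfV normr_id mulVf.
have -> : `|T h| = `|dotp (T h) k|.
  rewrite dotpZr fmorphV/= (conj_Creal (normr_real _)) -sqr_norm_dotp.
  by rewrite expr2 mulKf// normr_id.
have i1 : `|'i : R[i]| = 1 by rewrite normCi.
rewrite -(ler_pM2l (ltr0n _ 4)) -[X in X * `|_|]normr_nat -normrM polarization.
(* By the parallelogram law each pair of squares adds up to 4, so the bound is [8 * M] for
   [4 * |T h|]: hence the factor 2. *)
apply: (@le_trans _ _ (M * (`|h + k| ^+ 2 + `|h - k| ^+ 2)
    + M * (`|h + 'i *: k| ^+ 2 + `|h - 'i *: k| ^+ 2))).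
  rewrite !mulrDr addrA.
  by do ![apply: (le_trans (ler_normD _ _)); apply: lerD];
    rewrite ?normrN ?normrM ?i1 ?mul1r; apply: TM.
rewrite !parallelogram h1 k1 normrZ i1 mul1r k1 expr1n.
by rewrite le_eqVlt; apply/orP; left; apply/eqP; ring.
Qed.

Lemma sandwich_norm_le (R : realType) (H : hilbertType R)
    (S A : boundedOp H) :
  positive_op (A - S) -> positive_op (A + S) -> `|S| <= 2 * `|A|.
Proof.
move=> AS1 AS2; apply: norm_quadratic_le => // h.
have := AS1 h; rewrite boundedOpBE linearBl subr_ge0 => SA.
have := AS2 h; rewrite boundedOpDE linearDl -lerBlDr sub0r => AS.
(* The sum of [A - S] and [A + S] is twice [A]. *)
have A0 : 0 <= dotp (A h) h.
  rewrite -(pmulrn_lge0 _ (ltn0Sn 1)) mulr2n.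
  have := addr_ge0 (AS1 h) (AS2 h).
  by rewrite boundedOpBE boundedOpDE linearBl linearDl addrACA addNr addr0.
(* A two-sided bound controls the modulus only of a real number; this form is real as a difference
   of two nonnegative ones. *)
have SR : dotp (S h) h \is Num.real.
  rewrite -[dotp _ _](addKr (dotp (A h) h)) addrC realB ?ger0_real//.
  by rewrite -linearDl; exact: AS2.
have: `|dotp (S h) h| <= dotp (A h) h by rewrite real_ler_norml// lerNl AS.
move=> /le_trans; apply; rewrite -(ger0_norm A0).
rewrite (le_trans (norm_dotp_le _ _ _ _))// expr2 mulrA.
by rewrite ler_wpM2r// normr_boundedOpE le_opnorm.
Qed.

(** Homogeneity extends the bound from the unit sphere to every nonzero vector. *)
Lemma op_norm_bounded (R : realType) (X : normedModType R[i])
    (H : hilbertType R) (F : X -> boundedOp H) :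
  op_norm_on F -> bounded_op_norm F ->
  exists2 M : R[i], 0 <= M & forall x, `|F x| <= M * `|x|.
Proof.
move=> [_ _ FZ F0] /pinfty_ex_gt0[M M0 FM]; exists M; first exact: ltW.
move=> x; have [->|x0] := eqVneq x 0.
  by have /F0 -> := erefl (0 : X); rewrite !normr0 mulr0.
have nx0 : `|x| != 0 by rewrite normr_eq0.
have {1}-> : x = `|x| *: (`|x|^-1 *: x) by rewrite scalerA divff// scale1r.
rewrite FZ normrZ !normr_id mulrC.
by rewrite ler_wpM2r// FM//= normrZ normfV normr_id mulVf.
Qed.

Lemma op_norm_lipschitz (R : realType) (X : normedModType R[i])
    (H : hilbertType R) (F : X -> boundedOp H) :
  op_norm_on F -> bounded_op_norm F ->
  exists2 M : R[i], 0 < M & forall x y, `|F x - F y| <= M * `|x - y|.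
Proof.
move=> Fnorm /(op_norm_bounded _ _ _ _ Fnorm)[M M0 FM].
have [_ FD FZ _] := Fnorm.
(* The [+ 1] makes the constant positive, so that radii can be divided by it. *)
exists (2 * M + 1) => [|x y]; first by rewrite ltr_wpDl// mulr_ge0.
rewrite (@le_trans _ _ (2 * `|F (x - y)|))//; last first.
  by rewrite [(_ + 1) * _]mulrDl ler_wpDr ?mul1r// -mulrA ler_wpM2l.
have FN : F (y - x) = F (x - y).
  by rewrite -opprB -scaleN1r FZ normrN1 scale1r.
apply: sandwich_norm_le => h.
- have := FD (x - y) y h; rewrite subrK.
  by rewrite opprB addrA.
- have := FD (y - x) x h; rewrite subrK FN.
  by rewrite addrA.
Qed.

Theorem theorem1p7 (R : realType) (X : normedModType R[i]) (H : hilbertType R)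
    (F : X -> boundedOp H) :
  closed [set: X] ->
  op_norm_on F ->
  bounded_op_norm F ->
  complete_wrt F <-> {for 0, continuous F}.
Proof.
move=> _ Fnorm /(op_norm_lipschitz _ _ _ _ Fnorm)[M M0 FM].
(* The radius [e / M] does not depend on the point, so this serves both for continuity at 0 and for
   Cauchy sequences. *)
have Fball (x y : X) (e : R[i]) : ball x (e / M) y -> ball (F x) e (F y).
  rewrite -!ball_normE /ball_/= ltr_pdivlMr// mulrC.
  exact: le_lt_trans (FM _ _).
split=> _.
- apply/cvg_ballP => e e0; near=> x; apply: Fball; near: x.
  by apply: nbhsx_ballx; rewrite divr_gt0.
- move=> x_ /cauchy_ballP xcauchy; apply/cauchy_ballP => e e0.
  rewrite near_map2; have := xcauchy (e / M) (divr_gt0 e0 M0).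
  rewrite near_map2; apply: filterS => -[m n] /=; exact: Fball.
Unshelve. all: by end_near. Qed.
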